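(* Let $\hat V_{\mathrm{nw}}^{\pi}=n^{-1}\sum_{i=1}^n\sum_{a\in\mathcal{A}}\hat f^{\pi}(p_{ia})$ be the nonparametric weighting (NW) estimator of the target-policy value $V^{\pi}$. Here $\hat f^{\pi}$ is the $P$-spline estimator of $f^{\pi}\in W^q$ (Sobolev space of order $q$) obtained by regressing $\{\pi_{ia_i}r_{ia_i}\}_{i=1}^n$ on $\{p_{ia_i}\}_{i=1}^n$, and it is assumed to attain the rate $$\mathbb{E}\left[(\hat f^{\pi}(p_{ia})-f^{\pi}(p_{ia}))^2\right]=O(n^{-2q/(1+2q)}).$$ Let $K=|\mathcal{A}|$. Then: (a) The bias of the NW estimator satisfies $$\mathbb{E}(\hat V_{\mathrm{nw}}^{\pi})-V^{\pi}=O\left(Kn^{-q/(1+2q)}\right).$$ (b) The mean squared error of the NW estimator satisfies $$\mathbb{E}\left[(\hat V_{\mathrm{nw}}^{\pi}-V^{\pi})^2\right]=O\left(K^2n^{-2q/(1+2q)}\right).$$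
   Context: Setting (off-policy evaluation in contextual bandits). $\mathcal{X}$ is a context space, $\mathcal{A}$ is a finite action space with $K=|\mathcal{A}|$, and $\mathcal{D}$ is a distribution over pairs $(x,r)$ with $x\in\mathcal{X}$ and $r=(r_a)_{a\in\mathcal{A}}$ a real vector of rewards for all actions. Data are generated as follows: the environment draws i.i.d. pairs $(x_i,r_i)\sim\mathcal{D}$, $i=1,\dots,n$. Given $x_i$, the behavior policy draws $a_i\in\mathcal{A}$ with probabilities $p_{ia}=\mathbb{P}(a\mid x_i)$, and only the reward $r_{ia_i}$ is revealed. Rewards satisfy $r_{ia}=\mu_{ia}+\epsilon_{ia}$ with $\mu_{ia}=\mathbb{E}[r_a\mid x_i]$ and $\epsilon_{ia}$ zero-mean with finite variance. The target policy $\pi$ chooses action $a$ at context $x_i$ with probability $\pi_{ia}=\pi(a\mid x_i)$, and its value is $V^{\pi}=\mathbb{E}_{(x,r)\sim\mathcal{D}}[r_{\pi(x)}]=\mathbb{E}\left[\sum_{a\in\mathcal{A}}\pi(a\mid x)r_a\right]$. Model. $f^{\pi}$ is defined by $f^{\pi}(p_{ia})=\mathbb{E}[\pi_{ia}r_{ia}\mid p_{ia}]$. It is assumed that, conditional on $p_{ia}$, the action assignment $a_i$ is independent of $\pi_{ia}r_{ia}$, so that $\pi_{ia_i}r_{ia_i}=f^{\pi}(p_{ia_i})+\epsilon^{\pi}_{ia_i}$, $i=1,\dots,n$, with error terms of mean zero and variance $\sigma^2_{\pi,ia_i}$. Under this model $V^{\pi}=\mathbb{E}\left[\sum_{a\in\mathcal{A}}f^{\pi}(p_{ia})\right]$.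 $P$-spline estimator. For a univariate regression $y_i=f(t_i)+\zeta_i$, $i=1,\dots,n$, with $t_i\in(0,1)$ and $\zeta_i$ of conditional mean zero given $t_i$, assume $f\in W^q[0,1]$, i.e. $f$ has $q-1$ absolutely continuous derivatives and $\int_0^1[f^{(q)}(t)]^2\,dt<\infty$. Let $B_1,\dots,B_{J(n)+d}$ be the $d$-th degree $B$-spline basis functions with knots $0=\kappa_0<\kappa_1<\cdots<\kappa_{J(n)}=1$, $J(n)=o(n)$. The estimator is $\hat f(t)=\sum_{k=1}^{J(n)+d}\hat\beta_kB_k(t)$, where $\hat\beta$ minimizes $$\sum_{i=1}^n\Big[y_i-\sum_{k=1}^{J(n)+d}\beta_kB_k(t_i)\Big]^2+\lambda_n\sum_{k=2}^{J(n)+d}(\beta_k-\beta_{k-1})^2.$$ Here it is applied with $y_i=\pi_{ia_i}r_{ia_i}$ and $t_i=p_{ia_i}$, giving $\hat f^{\pi}$. The smoothing parameter is chosen as $\lambda_n=O(n^{-1/(1+2q)})$. Under regularity conditions the resulting optimal convergence rate is $\mathbb{E}[(\hat f(t)-f(t))^2]=O(n^{-2q/(1+2q)})$, and this rate is adopted as a standing assumption, applied at the points $p_{ia}$. The $O(\cdot)$ statements are as $n\to\infty$. *)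

(* Defs.v *)
From HB Require Import structures.
From mathcomp Require Import all_boot all_order all_algebra.
From mathcomp Require Import all_classical all_reals all_analysis.

Set Implicit Arguments.
Unset Strict Implicit.
Unset Printing Implicit Defensive.

Import Order.TTheory GRing.Theory Num.Theory.
Import numFieldNormedType.Exports.

Local Open Scope classical_set_scope.
Local Open Scope ring_scope.

Section sobolev.
Context {R : realType}.

Definition abs_continuous (I : set R) (g : R -> R) : Prop :=
  forall e : R, 0 < e -> exists2 d : R, 0 < d &
    forall (m : nat) (u v : 'I_m -> R),
      (forall k, [/\ I (u k), I (v k) & u k <= v k]) ->
      (forall k l, k != l -> v k <= u l \/ v l <= u k) ->
      \sum_k (v k - u k) < d ->
      \sum_k `|g (v k) - g (u k)| < e.

(* The derivatives of f are only taken in the open interval, because f is a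
   function on R whose values outside [0, 1] are irrelevant; absolute
   continuity on ]0, 1[ is the same as that of the extension to [0, 1].  The
   last derivative exists almost everywhere only. *)
Definition sobolev (q : nat) (f : R -> R) : Prop :=
  [/\ abs_continuous `[0, 1] f,
      forall k, (k < q)%N -> abs_continuous `]0, 1[ (derive1n k f),
      forall k, (k.+1 < q)%N ->
        forall t, t \in `]0, 1[ -> derivable (derive1n k f) t 1 &
      (\int[lebesgue_measure]_(t in `]0%R, 1%R[) ((derive1n q f t) ^+ 2)%:E < +oo)%E].

End sobolev.

Section pspline.
Context {R : realType}.

(* tau lists the knots kappa_0 < ... < kappa_J preceded and followed by the d
   auxiliary knots needed to get J + d basis functions of degree d:
   tau j = kappa_(j - d). *)
Definition spline_knots (J d : nat) (tau : nat -> R) : Prop :=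
  [/\ (0 < J)%N, tau d = 0, tau (d + J)%N = 1,
      forall j, (d <= j < d + J)%N -> tau j < tau j.+1 &
      forall j, (j < J + d.*2)%N -> tau j <= tau j.+1].

(* Cox-de Boor recursion; the usual convention 0 / 0 = 0 for coincident
   auxiliary knots is that of the division of R. *)
Fixpoint bspline (tau : nat -> R) (d j : nat) (t : R) : R :=
  if d is d'.+1 then
    (t - tau j) / (tau (j + d)%N - tau j) * bspline tau d' j t +
    (tau (j + d).+1 - t) / (tau (j + d).+1 - tau j.+1) * bspline tau d' j.+1 t
  else if tau j <= t < tau j.+1 then 1 else 0.

Definition spline (m d : nat) (tau : nat -> R) (b : 'rV[R]_m) (t : R) : R :=
  \sum_(k < m) b ord0 k * bspline tau d k t.

Definition pspline_loss (n m d : nat) (tau : nat -> R) (lambda : R)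
    (t y : 'I_n -> R) (b : 'rV[R]_m) : R :=
  \sum_(i < n) (y i - spline d tau b (t i)) ^+ 2 +
  lambda * \sum_(k < m) \sum_(l < m | l == k.+1 :> nat)
             (b ord0 l - b ord0 k) ^+ 2.

Definition pspline_fit (n m d : nat) (tau : nat -> R) (lambda : R)
    (t y : 'I_n -> R) (b : 'rV[R]_m) : Prop :=
  forall b' : 'rV[R]_m,
    pspline_loss d tau lambda t y b <= pspline_loss d tau lambda t y b'.

End pspline.

Section conditional.
Context {R : realType} {dO dT : measure_display} {Omega : measurableType dO}
        {T : measurableType dT} (P : probability Omega R).

(* G is a version of E[Y | Z] *)
Definition is_condexp (Z : Omega -> T) (Y G : Omega -> R) : Prop :=
  [/\ P.-integrable setT (EFin \o Y), P.-integrable setT (EFin \o G),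
      forall B, measurable B ->
        preimage_set_system setT Z measurable (G @^-1` B) &
      forall B, measurable B ->
        (\int[P]_(w in Z @^-1` B) (Y w)%:E =
         \int[P]_(w in Z @^-1` B) (G w)%:E)%E].

(* a and W are independent conditionally on Z *)
Definition cond_independent (A : finType) (Z : Omega -> T)
    (a : Omega -> A) (W : Omega -> R) : Prop :=
  forall (b : A) (B : set R), measurable B ->
    exists g h : Omega -> R,
      [/\ is_condexp Z \1_[set w | a w = b] g,
          is_condexp Z \1_(W @^-1` B) h &
          is_condexp Z \1_([set w | a w = b] `&` W @^-1` B)
                       (fun w => g w * h w)].

End conditional.

Section bandit.
Context {R : realType} {dX dO : measure_display} {X : measurableType dX}
        {A : finType} {Omega : measurableType dO}.

(* p a x is the probability p(a | x). *)
Definition policy (p : A -> X -> R) : Prop :=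
  (forall a, measurable_fun setT (p a)) /\
  (forall x, (forall a, 0 <= p a x) /\ \sum_a p a x = 1).

Definition reward (r : #|A|.-tuple R) (a : A) : R := tnth r (enum_rank a).

Definition policy_value (D : probability (X * #|A|.-tuple R)%type R)
    (pi : A -> X -> R) : R :=
  \int[D]_z \sum_a pi a z.1 * reward z.2 a.

Variable P : probability Omega R.
Variables (x : nat -> Omega -> X) (r : nat -> Omega -> #|A|.-tuple R)
          (act : nat -> Omega -> A).

(* An event of the sigma-algebra generated by (x_i, r_i, a_i), where the finite
   set of actions is discrete, is given by a family of measurable sets
   indexed by the actions. *)
Definition unit_event (i : nat) (B : A -> set (X * #|A|.-tuple R)) :
    set Omega :=
  [set w | B (act i w) (x i w, r i w)].

Definition independent_units : Prop :=
  forall (s : seq nat) (B : nat -> A -> set (X * #|A|.-tuple R)),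
    uniq s -> (forall i a, measurable (B i a)) ->
    (P (\bigcap_(i in [set` s]) unit_event i (B i)) =
     \prod_(i <- s) P (unit_event i (B i)))%E.

Variables (D : probability (X * #|A|.-tuple R)%type R) (p pi : A -> X -> R)
          (mu : A -> X -> R).

Record bandit_data : Prop := BanditData {
  context_measurable : forall i, measurable_fun setT (x i);
  reward_measurable : forall i, measurable_fun setT (r i);
  action_measurable : forall i a, measurable [set w | act i w = a];
  units_independent : independent_units;
  pair_law : forall i (B : set (X * #|A|.-tuple R)), measurable B ->
    P [set w | B (x i w, r i w)] = D B;
  action_law : forall i a,
    is_condexp P (x i) \1_[set w | act i w = a] (p a \o x i);
  reward_mean : forall i a,
    is_condexp P (x i) (fun w => reward (r i w) a) (mu a \o x i);
  reward_noise : forall i a,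
    P.-integrable setT
      (fun w => ((reward (r i w) a - mu a (x i w)) ^+ 2)%:E) }.

(* t_i and y_i *)
Definition logged_propensity (i : nat) (w : Omega) : R :=
  p (act i w) (x i w).
Definition weighted_reward (i : nat) (w : Omega) : R :=
  pi (act i w) (x i w) * reward (r i w) (act i w).

Variable f : R -> R.

Definition residual (i : nat) (w : Omega) : R :=
  weighted_reward i w - f (logged_propensity i w).

Record propensity_model : Prop := PropensityModel {
  model_mean : forall i a,
    is_condexp P (fun w => p a (x i w))
      (fun w => pi a (x i w) * reward (r i w) a) (fun w => f (p a (x i w)));
  model_independence : forall i a,
    cond_independent P (fun w => p a (x i w)) (act i)
      (fun w => pi a (x i w) * reward (r i w) a);
  propensity_range : forall i,
    {ae P, forall w, 0 < logged_propensity i w < 1};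
  residual_mean : forall i,
    is_condexp P (logged_propensity i) (residual i) (cst 0);
  residual_variance : forall i,
    P.-integrable setT (fun w => (residual i w ^+ 2)%:E) }.

Variables (q d : nat) (J : nat -> nat) (tau : nat -> nat -> R)
          (lambda : nat -> R)
          (beta : forall n : nat, Omega -> 'rV[R]_(J n + d)).

(* The minimiser is required to be a random vector, so that the expectations
   of the estimator make sense; if lambda n = 0 it may fail to be unique. *)
Record pspline_estimator : Prop := PsplineEstimator {
  knots_of : forall n, spline_knots (J n) d (tau n);
  knots_growth : (fun n => (J n)%:R : R) =o_\oo (fun n => n%:R : R);
  smoothing_ge0 : forall n, 0 <= lambda n;
  smoothing_rate :
    lambda =O_\oo (fun n => n%:R `^ (- (1 / (1 + 2 * q%:R))) : R);
  coef_measurable : forall n k, measurable_fun setT (fun w => beta n w ord0 k);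
  coef_fit : forall n w,
    pspline_fit d (tau n) (lambda n)
      (fun i : 'I_n => logged_propensity i w)
      (fun i : 'I_n => weighted_reward i w) (beta n w) }.

Definition fhat (n : nat) (w : Omega) (t : R) : R :=
  spline d (tau n) (beta n w) t.

(* The constants are uniform in the unit i <= n and in the action a. *)
Definition pspline_rate (C : R) (N : nat) : Prop :=
  forall n i a, (N <= n)%N -> (i < n)%N ->
    ('E_P[fun w => ((fhat n w (p a (x i w)) - f (p a (x i w))) ^+ 2)%R] <=
     (C * n%:R `^ (- (2 * q%:R / (1 + 2 * q%:R))))%:E)%E.

Definition nw_estimator (n : nat) (w : Omega) : R :=
  n%:R^-1 * \sum_(i < n) \sum_a fhat n w (p a (x i w)).

End bandit.

(* Main.v *)
Require Import Defs.
From HB Require Import structures.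
From mathcomp Require Import all_boot all_order all_algebra.
From mathcomp Require Import all_classical all_reals all_analysis.
From mathcomp Require Import measurable_realfun ring lra.

Set Implicit Arguments.
Unset Strict Implicit.
Unset Printing Implicit Defensive.

Import Order.TTheory GRing.Theory Num.Theory.
Import numFieldNormedType.Exports.

Local Open Scope classical_set_scope.
Local Open Scope ring_scope.

(** With h x := sum_a f (p(a|x)), the error of the estimator splits as
    Vnw - V = n^-1 sum_(i,a) (fhat - f)(p_ia) + n^-1 sum_i (h (x_i) - V).
    The rate assumption and Cauchy-Schwarz bound the second moment of the first
    part by C0 K^2 n^(-2q/(1+2q)), hence its mean by the square root of that.
    The second part has mean 0, and since h is bounded by K sup_[0,1] |f| and
    the x_i are independent, its second moment is at most
    (2 K sup |f|)^2 / n <= (2 K sup |f|)^2 n^(-2q/(1+2q)). *)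

(** * Preliminaries: squares of finite sums, and boundedness of [f] on the unit interval *)

Lemma sqr_sum_le (R : realDomainType) (I : finType) (u : I -> R) :
  (\sum_i u i) ^+ 2 <= #|I|%:R * \sum_i u i ^+ 2.
Proof.
have le2 (v : I -> R) :
    \sum_i \sum_j (v i * v j) *+ 2 <= \sum_i \sum_j (v i ^+ 2 + v j ^+ 2).
  apply: ler_sum => i _; apply: ler_sum => j _.
  by rewrite -subr_ge0 addrAC -sqrrB sqr_ge0.
(* Both sides are doubled, so that the double-sum comparison [le2] applies without division. *)
rewrite -(ler_pMn2r (ltn0Sn 1)) expr2 mulr_suml -sumrMnl.
under eq_bigr do rewrite mulr_sumr -sumrMnl.
apply: le_trans (le2 u) _.
under eq_bigr do rewrite big_split/= sumr_const.
by rewrite big_split/= sumr_const -sumrMnl mulr2n mulr_natl sumrMnl.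
Qed.

(** Composing [f] with the projection onto the compact interval [0, 1] gives a continuous bounded
    function. Propensities lie in [0, 1], so [g] can replace [f] wherever measurability or a bound
    is required. *)
Lemma abs_continuous_extension (R : realType) (f : R -> R) :
  abs_continuous `[0, 1] f ->
  exists g : R -> R, [/\ measurable_fun setT g,
    exists2 M : R, 0 <= M & forall t, `|g t| <= M &
    forall t, 0 <= t <= 1 -> g t = f t].
Proof.
move=> acf.
(* f need not be measurable outside [0, 1], so its argument is truncated. *)
pose clamp (t : R) := if t <= 0 then 0 else if 1 <= t then 1 else t.
have clamp01 t : [set` `[0, 1]] (clamp t).
  rewrite /= in_itv/= /clamp.
  by have [?|?] := leP t 0; have [?|?] := leP 1 t; apply/andP; split; lra.
have clampE t : 0 <= t <= 1 -> clamp t = t.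
  by rewrite /clamp; have [?|?] := leP t 0; have [?|?] := leP 1 t; lra.
have clamp_mono s t : s <= t -> clamp s <= clamp t /\ clamp t - clamp s <= t - s.
  rewrite /clamp; have [?|?] := leP t 0; have [?|?] := leP s 0;
  by have [?|?] := leP 1 t; have [?|?] := leP 1 s; split; lra.
have cg : continuous (f \o clamp).
  move=> t; apply/cvgrPdist_lt => e /acf[d d0 acd].
  have close s u : s <= u -> u - s < d -> `|f (clamp u) - f (clamp s)| < e.
    move=> su usd.
    (* The projection is monotone and 1-Lipschitz, so a family of one interval suffices. *)
    have /= := acd 1%N (fun=> clamp s) (fun=> clamp u); rewrite !big_ord1; apply.
    - by move=> _; split; rewrite ?(clamp_mono _ _ su).1//; exact: clamp01.
    - by move=> k l; rewrite !ord1.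
    - exact: le_lt_trans (clamp_mono _ _ su).2 _.
  near=> s; have std : `|t - s| < d by near: s; exact: cvgr_dist_lt.
  have [ts|st] := leP t s.
    rewrite distrC; apply: close => //.
    by rewrite -(ger0_norm (x := s - t)) ?subr_ge0// distrC.
  apply: close (ltW st) _.
  by rewrite -(ger0_norm (x := t - s)) ?subr_ge0 ?ltW.
have [M [_ bM]] : bounded_set ((f \o clamp) @` [set` `[0, 1]]).
  apply/compact_bounded/continuous_compact; last exact: segment_compact.
  exact: continuous_subspaceT.
exists (f \o clamp); split.
- exact: continuous_measurable_fun.
(* Boundedness supplies bounds only strictly above [M], which may itself be negative. *)
- exists (`|M| + 1) => // t; apply: (bM (`|M| + 1)).
    by rewrite (le_lt_trans (ler_norm _))// ltrDl.
  by exists (clamp t); [exact: clamp01|rewrite /= clampE//; exact: clamp01].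
- by move=> t t01 /=; rewrite clampE.
Unshelve. all: by end_near. Qed.

(** * Real-valued integrals and the product rule for independent variables *)

Section integration.
Context {d : measure_display} {T : measurableType d} {R : realType}.
Implicit Types (mu : {measure set T -> \bar R}) (P : probability T R).

Lemma EFin_Rintegral mu (D : set T) (u : T -> R) : measurable D ->
  mu.-integrable D (EFin \o u) ->
  (\int[mu]_(w in D) u w)%:E = (\int[mu]_(w in D) (u w)%:E)%E.
Proof. by move=> mD iu; rewrite fineK//; exact: integrable_fin_num. Qed.

Lemma integrable_sumr mu (D : set T) (I : Type) (s : seq I) (u : I -> T -> R) :
  measurable D -> (forall i, mu.-integrable D (EFin \o u i)) ->
  mu.-integrable D (EFin \o (fun w => \sum_(i <- s) u i w)).
Proof.
move=> mD iu; rewrite [X in integrable _ _ X](_ : _ =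
    (fun w => \sum_(i <- s) (EFin \o u i) w)%E); last first.
  by apply/funext => w /=; rewrite sumEFin.
exact: integrable_sum.
Qed.

Lemma Rintegral_sum mu (D : set T) (I : Type) (s : seq I) (u : I -> T -> R) :
  measurable D -> (forall i, mu.-integrable D (EFin \o u i)) ->
  \int[mu]_(w in D) (\sum_(i <- s) u i w) =
  \sum_(i <- s) \int[mu]_(w in D) u i w.
Proof.
move=> mD iu; apply: EFin_inj; rewrite EFin_Rintegral//; last exact: integrable_sumr.
under eq_integral do rewrite -sumEFin.
rewrite integral_sum// -sumEFin; apply: eq_bigr => i _.
by rewrite EFin_Rintegral.
Qed.

Lemma integrableZl_EFin mu (D : set T) (k : R) (u : T -> R) : measurable D ->
  mu.-integrable D (EFin \o u) ->
  mu.-integrable D (EFin \o (fun w => k * u w)).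
Proof. by move=> mD; exact: integrableZl. Qed.

Lemma bounded_integrable P (u : T -> R) (c : R) : measurable_fun setT u ->
  (forall w, `|u w| <= c) -> P.-integrable setT (EFin \o u).
Proof.
move=> mu uc; apply: measurable_bounded_integrable => //.
  exact: fin_num_fun_lty.
exists c; split; first exact: num_real.
by move=> m cm w _; exact: le_trans (uc w) (ltW cm).
Qed.

Lemma Rintegral_prob_cst P (k : R) : \int[P]_w k = k.
Proof. by rewrite Rintegral_cst// [X in fine X](probability_setT P) mulr1. Qed.

(** By independence the joint law agrees with the product of the marginal laws on rectangles, hence
    on all measurable sets; Fubini then factors the integral. *)
Lemma Rintegral_independentM P (U V : T -> R) :
  measurable_fun setT U -> measurable_fun setT V ->
  (forall A B, measurable A -> measurable B ->
     P (U @^-1` A `&` V @^-1` B) = (P (U @^-1` A) * P (V @^-1` B))%E) ->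
  P.-integrable setT (EFin \o U) -> P.-integrable setT (EFin \o V) ->
  P.-integrable setT (EFin \o (fun w => U w * V w)) ->
  \int[P]_w (U w * V w) = (\int[P]_w U w) * (\int[P]_w V w).
Proof.
move=> mU mV UV iU iV iUV.
pose X : {RV P >-> R} := HB.pack U (isMeasurableFun.Build _ _ _ _ U mU).
pose Y : {RV P >-> R} := HB.pack V (isMeasurableFun.Build _ _ _ _ V mV).
pose m1 := distribution P X; pose m2 := distribution P Y.
have mXY : measurable_fun setT (fun w => (U w, V w)).
  exact: measurable_fun_pair.
pose prod (z : R * R) := (z.1 * z.2)%:E.
have mprod : measurable_fun setT prod.
  by apply/measurable_EFinP; exact: measurable_funM.
have jointE A : measurable A -> pushforward P (fun w => (U w, V w)) A = (m1 \x m2)%E A.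
  move=> mA; apply/esym.
  pose XY : {mfun T >-> (R * R)%type} :=
    HB.pack (fun w => (U w, V w)) (isMeasurableFun.Build _ _ _ _ _ mXY).
  by rewrite (@product_measure_unique _ _ _ _ _ m1 m2 (distribution P XY)).
(* Fubini needs integrability under the product law; the integral of the absolute value is pulled
   back to [P], where [iUV] makes it finite. *)
have iprod : (m1 \x m2)%E.-integrable setT prod.
  apply/integrableP; split => //.
  rewrite (eq_measure_integral (pushforward P (fun w => (U w, V w)))); last first.
    by move=> A mA _ /=; rewrite jointE.
  rewrite ge0_integral_pushforward//; last exact: measurableT_comp.
  by have /integrableP[] := iUV.
have iid1 : m1.-integrable setT EFin by exact: (integrable_pushforward mU).
have iid2 : m2.-integrable setT EFin by exact: (integrable_pushforward mV).
have E1 : (\int[m1]_s s%:E = \int[P]_w (U w)%:E)%E.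
  by rewrite integral_pushforward.
have E2 : (\int[m2]_s s%:E = \int[P]_w (V w)%:E)%E.
  by rewrite integral_pushforward.
apply: EFin_inj; rewrite EFinM !EFin_Rintegral//.
transitivity (\int[pushforward P (fun w => (U w, V w))]_z prod z)%E.
  by rewrite integral_pushforward.
rewrite (eq_measure_integral (m1 \x m2)%E); last by move=> A mA _; exact: jointE.
rewrite -integral12_prod_meas1// /fubini_F/=.
transitivity (\int[m1]_s (s%:E * (\int[P]_w V w)%:E))%E.
  by apply: eq_integral => s _; rewrite EFin_Rintegral// -E2 -integralZl.
by rewrite integralZr// E1 EFin_Rintegral.
Qed.

End integration.

(** * Measurability of the spline basis *)

Lemma measurable_bspline (R : realType) (tau : nat -> R) (d j : nat) :
  measurable_fun setT (bspline tau d j).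
Proof.
elim: d j => [|d IH] j.
  rewrite (_ : bspline tau 0 j = \1_[set` `[tau j, tau j.+1[])//.
  by apply/funext => t; rewrite indicE mem_setE in_itv/=; case: ifP.
apply: measurable_funD; apply: measurable_funM (IH _); apply: measurable_funM => //.
- exact: measurable_funB.
- exact: measurable_funB.
Qed.

(** * First and second moments of sums *)

Section mean_square.
Context {d : measure_display} {T : measurableType d} {R : realType}
        (P : probability T R).

(** Constants are integrable on a probability space, and expanding (|Z| - 1)^2 >= 0 shows that Z^2 +
    1 dominates |Z|. *)
Lemma integrable_of_sqr (Z : T -> R) : measurable_fun setT Z ->
  P.-integrable setT (EFin \o (fun w => Z w ^+ 2)) ->
  P.-integrable setT (EFin \o Z).
Proof.
move=> mZ iZ2; apply: (@le_integrable _ _ _ P _ measurableT _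
    (EFin \o (fun w => Z w ^+ 2 + 1))).
- exact/measurable_EFinP.
- move=> w _; rewrite /= lee_fin (ger0_norm (x := _ + 1)) ?addr_ge0 ?sqr_ge0//.
  rewrite -real_normK ?num_real//; have := sqr_ge0 (`|Z w| - 1); nra.
- apply: (@integrableD _ _ _ P _ measurableT (EFin \o (fun w => Z w ^+ 2)) (cst 1%:E)) => //.
  exact: (finite_measure_integrable_cst P 1).
Qed.

(** Cauchy-Schwarz would give the factor sqrt b; the weaker (b + 1) / 2 avoids the root and keeps
    the order in [c], which will be the convergence rate. *)
Lemma normr_Rintegral_le_of_sqr (Z : T -> R) (b c : R) : 0 < c ->
  measurable_fun setT Z ->
  P.-integrable setT (EFin \o (fun w => Z w ^+ 2)) ->
  \int[P]_w (Z w ^+ 2) <= b * c ^+ 2 ->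
  `|\int[P]_w Z w| <= (b + 1) / 2 * c.
Proof.
move=> c0 mZ iZ2 Z2b; have iZ := integrable_of_sqr mZ iZ2.
apply: le_trans (le_normr_Rintegral measurableT iZ) _.
have icst : P.-integrable setT (EFin \o cst (c / 2)).
  exact: finite_measure_integrable_cst.
have iZ2c : P.-integrable setT (EFin \o (fun w => (2 * c)^-1 * Z w ^+ 2)).
  exact: integrableZl_EFin.
(* AM-GM: |Z| <= Z^2 / (2 c) + c / 2 *)
apply: (@le_trans _ _ (\int[P]_w ((2 * c)^-1 * Z w ^+ 2 + c / 2))).
  apply: le_Rintegral => //.
  - exact: integrable_norm.
  - exact: (@integrableD _ _ _ P _ measurableT _ _ iZ2c icst).
  - move=> w _; rewrite -(ler_pM2l (x := 2 * c)) ?mulr_gt0//.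
    rewrite mulrDr mulVKf; last by rewrite gt_eqF// mulr_gt0.
    by rewrite -real_normK ?num_real//; have := sqr_ge0 (`|Z w| - c); nra.
rewrite RintegralD// Rintegral_prob_cst RintegralZl//.
rewrite -(ler_pM2l (x := 2 * c)) ?mulr_gt0// mulrDr mulVKf; last first.
  by rewrite gt_eqF// mulr_gt0.
nra.
Qed.

(** No independence is assumed, since the fitted values at different points share the same [beta].
    With pairs (i, a) as indices the cardinal is nK, and averaging over n leaves K. *)
Lemma sum_mean_square (I : finType) (Y : I -> T -> R) (b c : R) : 0 < c ->
  (forall i, measurable_fun setT (Y i)) ->
  (forall i, P.-integrable setT (EFin \o (fun w => Y i w ^+ 2))) ->
  (forall i, \int[P]_w (Y i w ^+ 2) <= b * c ^+ 2) ->
  [/\ P.-integrable setT (EFin \o (fun w => \sum_i Y i w)),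
      P.-integrable setT (EFin \o (fun w => (\sum_i Y i w) ^+ 2)),
      `|\int[P]_w (\sum_i Y i w)| <= #|I|%:R * ((b + 1) / 2 * c) &
      \int[P]_w ((\sum_i Y i w) ^+ 2) <= #|I|%:R ^+ 2 * (b * c ^+ 2)].
Proof.
move=> c0 mY iY2 Y2b.
have iY i : P.-integrable setT (EFin \o Y i) by exact: integrable_of_sqr.
have isum : P.-integrable setT (EFin \o (fun w => #|I|%:R * \sum_i Y i w ^+ 2)).
  by apply: integrableZl_EFin => //; exact: integrable_sumr.
have isq : P.-integrable setT (EFin \o (fun w => (\sum_i Y i w) ^+ 2)).
  apply: le_integrable isum => //.
    apply/measurable_EFinP; apply: measurable_funX.
    exact: measurable_sum.
  move=> w _; rewrite /= lee_fin !ger0_norm ?sqr_ge0//; first exact: sqr_sum_le.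
  by rewrite mulr_ge0// sumr_ge0// => i _; exact: sqr_ge0.
split => //; first exact: integrable_sumr.
  rewrite Rintegral_sum//; apply: le_trans (ler_norm_sum _ _ _) _.
  rewrite mulr_natl -sumr_const; apply: ler_sum => i _.
  exact: normr_Rintegral_le_of_sqr.
apply: (@le_trans _ _ (\int[P]_w (#|I|%:R * \sum_i Y i w ^+ 2))).
  by apply: le_Rintegral => // w _; exact: sqr_sum_le.
rewrite RintegralZl//; last exact: integrable_sumr.
rewrite Rintegral_sum// expr2 -mulrA ler_wpM2l//.
by rewrite mulr_natl -sumr_const; apply: ler_sum.
Qed.

(** Only the [n] diagonal terms survive, so the second moment grows like n instead of n^2, and that
    of the average is of order 1/n. *)
Lemma orthogonal_sum_mean_square (n : nat) (U : 'I_n -> T -> R) (c : R) :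
  (forall i, measurable_fun setT (U i)) ->
  (forall i w, `|U i w| <= c) ->
  (forall i j, i != j -> \int[P]_w (U i w * U j w) = 0) ->
  P.-integrable setT (EFin \o (fun w => (\sum_i U i w) ^+ 2)) /\
  \int[P]_w ((\sum_i U i w) ^+ 2) <= n%:R * c ^+ 2.
Proof.
move=> mU Uc UU0.
have bUU i j w : `|U i w * U j w| <= c ^+ 2.
  by rewrite normrM expr2 ler_pM.
have iUU i j : P.-integrable setT (EFin \o (fun w => U i w * U j w)).
  by apply: (bounded_integrable P) (bUU i j); exact: measurable_funM.
have sqE : (fun w => (\sum_i U i w) ^+ 2) =
           (fun w => \sum_i \sum_j U i w * U j w).
  apply/funext => w; rewrite expr2 mulr_suml.
  by apply: eq_bigr => i _; rewrite mulr_sumr.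
have isum i : P.-integrable setT (EFin \o (fun w => \sum_j U i w * U j w)).
  exact: integrable_sumr.
rewrite sqE; split; first exact: integrable_sumr.
rewrite Rintegral_sum//.
rewrite -[n in n%:R]card_ord mulr_natl -sumr_const; apply: ler_sum => i _.
rewrite Rintegral_sum// (bigD1 i)//= big1 ?addr0; last first.
  by move=> j ji; rewrite UU0// eq_sym.
rewrite -[leRHS](Rintegral_prob_cst P); apply: le_Rintegral => //.
  exact: finite_measure_integrable_cst.
by move=> w _; rewrite (le_trans (ler_norm _)).
Qed.

End mean_square.

(** * Consequences of the sampling model *)

Section bandit_lemmas.
Context {R : realType} {dX dO : measure_display} {X : measurableType dX}
        {A : finType} {Omega : measurableType dO} (P : probability Omega R)
        (x : nat -> Omega -> X) (r : nat -> Omega -> #|A|.-tuple R)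
        (act : nat -> Omega -> A) (D : probability (X * #|A|.-tuple R)%type R)
        (p pi mu : A -> X -> R).
Hypothesis data : bandit_data P x r act D p mu.

(** [pair_law] moves the integral from [D] to [Omega]; testing the conditional expectation of
    [model_mean] on the whole space then replaces the weighted reward by [f]. As [i] is arbitrary,
    all units share this mean. *)
Lemma policy_value_model (f : R -> R) (i : nat) :
  policy pi -> propensity_model P x r act p pi f ->
  policy_value D pi = \int[P]_w (\sum_a f (p a (x i w))).
Proof.
move=> [mpi _] model.
have mxr : measurable_fun setT (fun w => (x i w, r i w)).
  by apply: measurable_fun_pair; [exact: context_measurable data i|
    exact: reward_measurable data i].
pose phi (z : X * #|A|.-tuple R) := \sum_a pi a z.1 * reward z.2 a.
have mphi : measurable_fun setT phi.
  apply: measurable_sum => a; apply: measurable_funM.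
    exact: measurableT_comp (mpi a) measurable_fst.
  exact: measurableT_comp (measurable_tnth _) measurable_snd.
have iYa a : P.-integrable setT
    (EFin \o (fun w => pi a (x i w) * reward (r i w) a)).
  by have [] := model_mean model i a.
have ifa a : P.-integrable setT (EFin \o (fun w => f (p a (x i w)))).
  by have [] := model_mean model i a.
transitivity (\int[P]_w phi (x i w, r i w)); last first.
  rewrite !Rintegral_sum//; apply: eq_bigr => a _; congr fine.
  by have [_ _ _ /(_ _ measurableT)] := model_mean model i a; rewrite preimage_setT.
congr fine; rewrite -/phi.
rewrite (eq_measure_integral (pushforward P (fun w => (x i w, r i w)))); last first.
  by move=> B mB _; apply: esym; exact: (pair_law data i mB).
rewrite integral_pushforward//; last first.
  exact: (integrable_sumr (index_enum A) measurableT iYa).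
exact/measurable_EFinP.
Qed.

Lemma context_independent (u : X -> R) (i j : nat) (B C : set R) :
  measurable_fun setT u -> i != j -> measurable B -> measurable C ->
  P ((u \o x i) @^-1` B `&` (u \o x j) @^-1` C) =
  (P ((u \o x i) @^-1` B) * P ((u \o x j) @^-1` C))%E.
Proof.
move=> mu_ ij mB mC.
(* Independence of units is applied to the list of the two indices, with events that ignore action
   and reward. The family must be measurable at every index, so [C] also serves away from [i] and
   [j]. *)
pose E k (_ : A) : set (X * #|A|.-tuple R) :=
  (u \o fst) @^-1` (if k == i then B else C).
have mE k a : measurable (E k a).
  rewrite /E -[X in measurable X]setTI.
  by apply: (measurableT_comp mu_ measurable_fst) => //; case: ifP.
have uij : uniq [:: i; j] by rewrite /= inE ij.
have := units_independent data uij mE.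
rewrite !big_cons big_nil mule1 {2 3}/unit_event /E eqxx eq_sym (negbTE ij) => <-.
congr (P _); apply/seteqP; split => w /=.
  move=> [Bw Cw] k; rewrite /= !inE => /orP[] /eqP ->; rewrite /unit_event/=.
    by rewrite eqxx.
  by rewrite eq_sym (negbTE ij).
move=> h; split.
  by have := h i; rewrite /unit_event/= inE eqxx; exact.
by have := h j; rewrite /unit_event/= !inE eqxx orbT eq_sym (negbTE ij); exact.
Qed.

End bandit_lemmas.

(* The O-constants C and N depend on f, q and the assumed rate only, so that
   the factor K = #|A| is meaningful. *)
Theorem proposition3p2 (R : realType) (q : nat) (f : R -> R) (C0 : R) (N0 : nat)
    (q_gt0 : (0 < q)%N) (f_sobolev : sobolev q f) :
  exists (C : R) (N : nat),
  forall (dX dO : measure_display) (X : measurableType dX) (A : finType)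
    (Omega : measurableType dO) (P : probability Omega R)
    (x : nat -> Omega -> X) (r : nat -> Omega -> #|A|.-tuple R)
    (act : nat -> Omega -> A)
    (D : probability (X * #|A|.-tuple R)%type R)
    (p pi mu : A -> X -> R)
    (d : nat) (J : nat -> nat) (tau : nat -> nat -> R) (lambda : nat -> R)
    (beta : forall n : nat, Omega -> 'rV[R]_(J n + d)),
  policy p -> policy pi ->
  bandit_data P x r act D p mu ->
  propensity_model P x r act p pi f ->
  pspline_estimator x r act p pi q tau lambda beta ->
  pspline_rate P x p f q tau beta C0 N0 ->
  let V := policy_value D pi in
  let Vnw := nw_estimator x p tau beta in
  (forall n : nat, (N <= n)%N ->
     (`| 'E_P[Vnw n] - V%:E | <=
      (C * (#|A|%:R * n%:R `^ (- (q%:R / (1 + 2 * q%:R)))))%:E)%E) /\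
  (forall n : nat, (N <= n)%N ->
     ('E_P[fun w => ((Vnw n w - V) ^+ 2)%R] <=
      (C * (#|A|%:R ^+ 2 * n%:R `^ (- (2 * q%:R / (1 + 2 * q%:R)))))%:E)%E).
Proof.
have [acf _ _ _] := f_sobolev.
have [g [mg [M M0 gM] gE]] := abs_continuous_extension acf.
(* [C0] may be negative; its absolute value still bounds the rate. *)
pose b : R := `|C0|; have b0 : 0 <= b by exact: normr_ge0.
(* The terms 2b and 8M^2 come from (u + v)^2 <= 2u^2 + 2v^2 applied to the two error parts, and 1
   covers the (b + 1) / 2 of the bias. The threshold keeps n positive, so that n^-1 is a true
   inverse. *)
exists (2 * b + 8 * M ^+ 2 + 1), (maxn N0 1).
move=> dX dO X A Omega P x r act D p pi mu d J tau lambda beta.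
move=> pol_p pol_pi data model est rate V Vnw.
have [mp p_prob] := pol_p.
have p01 a z : 0 <= p a z <= 1.
  have [p0 p1] := p_prob z; rewrite p0/= -p1 (bigD1 a)//= lerDl.
  by apply: sumr_ge0 => a' _; exact: p0.
have mpx i a : measurable_fun setT (fun w => p a (x i w)).
  exact: measurableT_comp (mp a) (context_measurable data i).
pose K : R := #|A|%:R; have K0 : 0 <= K by exact: ler0n.
pose h (z : X) := \sum_a g (p a z).
have mh : measurable_fun setT h.
  by apply: measurable_sum => a; exact: measurableT_comp mg (mp a).
have hM z : `|h z| <= K * M.
  rewrite (le_trans (ler_norm_sum _ _ _))// mulr_natl -sumr_const.
  by apply: ler_sum => a _; exact: gM.
have hV i : \int[P]_w h (x i w) = V.
  rewrite /V (policy_value_model data i pol_pi model).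
  by apply: eq_Rintegral => w _; apply: eq_bigr => a _; rewrite gE.
have mhx i : measurable_fun setT (h \o x i).
  exact: measurableT_comp mh (context_measurable data i).
have ihx i : P.-integrable setT (EFin \o (h \o x i)).
  by apply: (bounded_integrable P (c := K * M)) => // w; exact: hM.
have icst k : P.-integrable setT (EFin \o cst k).
  exact: finite_measure_integrable_cst.
have VM : `|V| <= K * M.
  rewrite -(hV 0%N) (le_trans (le_normr_Rintegral measurableT (ihx 0%N)))//.
  rewrite -[leRHS](Rintegral_prob_cst P); apply: le_Rintegral => //.
  - exact: integrable_norm.
  - exact: icst.
  - by move=> w _; exact: hM.
pose u z := h z - V.
have mu_ : measurable_fun setT u by exact: measurable_funB.
have uM z : `|u z| <= 2 * K * M.
  rewrite (le_trans (ler_normB _ _))// -mulrA mulr_natl mulr2n.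
  by rewrite lerD.
have mux i : measurable_fun setT (u \o x i).
  exact: measurableT_comp mu_ (context_measurable data i).
have iux i : P.-integrable setT (EFin \o (u \o x i)).
  by apply: (bounded_integrable P (c := 2 * K * M)) => // w; exact: uM.
have u0 i : \int[P]_w u (x i w) = 0.
  transitivity (\int[P]_w h (x i w) - \int[P]_w V).
    exact: RintegralB measurableT (ihx i) (icst V).
  by rewrite Rintegral_prob_cst hV subrr.
(* Contexts of distinct units are independent, so their centred values are uncorrelated. *)
have uu0 i j : i != j -> \int[P]_w (u (x i w) * u (x j w)) = 0.
  move=> ij; rewrite (@Rintegral_independentM _ _ _ P (u \o x i) (u \o x j))//.
  - by rewrite u0 mul0r.
  - by move=> B C mB mC; exact: (context_independent data mu_ ij mB mC).
  - apply: (bounded_integrable P (c := (2 * K * M) ^+ 2)).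
      exact: measurable_funM.
    by move=> w /=; rewrite normrM expr2 ler_pM//; exact: uM.
pose delta n i a w := fhat tau beta n w (p a (x i w)) - f (p a (x i w)).
have mdelta n i a : measurable_fun setT (delta n i a).
  apply: measurable_funB.
    apply: measurable_sum => k; apply: measurable_funM.
      exact: coef_measurable est n k.
    exact: measurableT_comp (measurable_bspline _ _ _) (mpx i a).
  rewrite (_ : (fun w => _) = (g \o (fun w => p a (x i w)))).
    exact: measurableT_comp mg (mpx i a).
  by apply/funext => w /=; rewrite gE.
(* Estimation error and sampling deviation, both before division by n; [err] runs over pairs to fit
   [sum_mean_square]. *)
pose err n w := \sum_(ia : 'I_n * A) delta n ia.1 ia.2 w.
pose dev n w := \sum_(i < n) u (x i w).
have decomp n w : (0 < n)%N -> Vnw n w = n%:R^-1 * (err n w + dev n w) + V.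
  move=> n0; have n0R : (n%:R : R) != 0 by rewrite pnatr_eq0 -lt0n.
  rewrite /dev sumrB sumr_const card_ord -[V *+ n]mulr_natl /Vnw /nw_estimator /err.
  rewrite -(pair_bigA _ (fun i a => delta n (i : 'I_n) a w))/=.
  rewrite addrA mulrBr mulKf// subrK -big_split/=; congr (_ * _).
  apply: eq_bigr => i _; rewrite -big_split/=; apply: eq_bigr => a _.
  by rewrite /delta gE// subrK.
pose c n : R := n%:R `^ (- (q%:R / (1 + 2 * q%:R))).
have c2 n : n%:R `^ (- (2 * q%:R / (1 + 2 * q%:R))) = c n ^+ 2.
  by rewrite -powR_mulrn ?powR_ge0// -powRrM; congr (_ `^ _); ring.
have q2 : 0 < 1 + 2 * q%:R :> R by rewrite ltr_pwDl// mulr_ge0.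
(* The exponent 2q/(1 + 2q) is at most 1, so the 1/n of the sampling part is absorbed by the squared
   rate. *)
have cn n : (0 < n)%N -> n%:R^-1 <= c n ^+ 2.
  move=> n0; rewrite -powR_inv1 ?ler0n// -c2; apply: ler_powR.
    by rewrite ler1n.
  by rewrite lerN2 ler_pdivrMr// mul1r lerDr.
have main n : (maxn N0 1 <= n)%N ->
  [/\ P.-integrable setT (EFin \o err n), P.-integrable setT (EFin \o dev n),
     \int[P]_w dev n w = 0 &
   [/\ P.-integrable setT (EFin \o (fun w => err n w ^+ 2)),
     P.-integrable setT (EFin \o (fun w => dev n w ^+ 2)),
     `|\int[P]_w err n w| <= n%:R * K * ((b + 1) / 2 * c n),
     \int[P]_w (err n w ^+ 2) <= (n%:R * K) ^+ 2 * (b * c n ^+ 2) &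
     \int[P]_w (dev n w ^+ 2) <= n%:R * (2 * K * M) ^+ 2]].
  rewrite geq_max => /andP[N0n n0].
  have c0 : 0 < c n by apply: powR_gt0; rewrite ltr0n.
  have rate_ia (ia : 'I_n * A) :
      (\int[P]_w (delta n ia.1 ia.2 w ^+ 2)%:E <= (b * c n ^+ 2)%:E)%E.
    have := rate n ia.1 ia.2 N0n (ltn_ord _).
    rewrite unlock c2 => /le_trans; apply.
    by rewrite lee_fin ler_wpM2r ?sqr_ge0// ler_norm.
  (* The rate bounds an extended-real expectation of a nonnegative function, so it already yields
     integrability. *)
  have idelta2 (ia : 'I_n * A) :
      P.-integrable setT (EFin \o (fun w => delta n ia.1 ia.2 w ^+ 2)).
    apply/integrableP; split.
      by apply/measurable_EFinP; apply: measurable_funX; exact: mdelta.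
    under eq_integral => w _ do rewrite gee0_abs ?lee_fin ?sqr_ge0//.
    exact: le_lt_trans (rate_ia ia) (ltry _).
  have [] := @sum_mean_square _ _ _ P _ (fun ia : 'I_n * A => delta n ia.1 ia.2)
    b (c n) c0 (fun ia => mdelta n ia.1 ia.2) idelta2.
    by move=> ia; rewrite -lee_fin EFin_Rintegral.
  rewrite card_prod card_ord natrM => ierr ierr2 errle err2le.
  have [||idev2 dev2le] := @orthogonal_sum_mean_square _ _ _ P n
    (fun i => u \o x i) (2 * K * M) (fun i => mux i).
  - by move=> i w; exact: uM.
  - by move=> i j ij; exact: uu0.
  split => //; first exact: (integrable_sumr _ measurableT (fun i : 'I_n => iux i)).
  rewrite (Rintegral_sum _ measurableT (fun i : 'I_n => iux i)) big1// => i _.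
  exact: u0.
split=> n Nn; have [ierr idev dev0 [ierr2 idev2 errle err2le dev2le]] := main n Nn;
  have {Nn} n0 : (0 < n)%N by move: Nn; rewrite geq_max => /andP[].
  have n0R : 0 < n%:R :> R by rewrite ltr0n.
  have ised : P.-integrable setT (EFin \o (fun w => err n w + dev n w)).
    exact: (@integrableD _ _ _ P _ measurableT _ _ ierr idev).
  have ised' : P.-integrable setT
      (EFin \o (fun w => n%:R^-1 * (err n w + dev n w))).
    exact: integrableZl_EFin.
  (* Bias: [dev] has mean zero, so only the estimation error contributes. *)
  have -> : ('E_P[Vnw n] = (n%:R^-1 * (\int[P]_w err n w) + V)%:E)%E.
    rewrite unlock; under eq_integral => w _ do rewrite decomp//.
    rewrite -EFin_Rintegral//; last first.
      exact: (@integrableD _ _ _ P _ measurableT _ _ ised' (icst V)).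
    rewrite (RintegralD measurableT ised' (icst V)) Rintegral_prob_cst.
    by rewrite RintegralZl// RintegralD// dev0 addr0.
  rewrite -EFinB addrK lee_fin normrM ger0_norm ?invr_ge0 ?ler0n//.
  rewrite ler_pdivrMl// (le_trans errle)//.
  rewrite [leRHS](_ : _ = n%:R * K * ((2 * b + 8 * M ^+ 2 + 1) * c n)); last first.
    by rewrite /K /c; ring.
  rewrite ler_wpM2l ?mulr_ge0 ?ler0n// ler_wpM2r ?powR_ge0//.
  by have := sqr_ge0 M; lra.
(* Mean squared error: the square of the sum is dominated pointwise by twice the sum of squares,
   which is integrable. *)
have n0R : 0 < n%:R :> R by rewrite ltr0n.
have ibound : P.-integrable setT
    (EFin \o (fun w => 2 * n%:R^-1 ^+ 2 * (err n w ^+ 2 + dev n w ^+ 2))).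
  apply: integrableZl_EFin => //.
  exact: (@integrableD _ _ _ P _ measurableT _ _ ierr2 idev2).
apply: (@le_trans _ _
    (\int[P]_w (2 * n%:R^-1 ^+ 2 * (err n w ^+ 2 + dev n w ^+ 2))%:E)%E).
  rewrite unlock; apply: ge0_le_integral => //.
  - by move=> w _; rewrite lee_fin sqr_ge0.
  - apply/measurable_EFinP; apply: measurable_funX.
    rewrite (_ : (fun w => _) = (fun w => n%:R^-1 * (err n w + dev n w))).
      have /measurable_EFinP merr := measurable_int P ierr.
      have /measurable_EFinP mdev := measurable_int P idev.
      by apply: measurable_funM => //; exact: measurable_funD.
    by apply/funext => w; rewrite decomp// addrK.
  - exact: measurable_int ibound.
  - move=> w _; rewrite lee_fin decomp// addrK exprMn.
    rewrite [leRHS](_ : _ = n%:R^-1 ^+ 2 * (2 * (err n w ^+ 2 + dev n w ^+ 2))).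
      by rewrite ler_wpM2l ?sqr_ge0//; have := sqr_ge0 (err n w - dev n w); nra.
    ring.
rewrite -EFin_Rintegral// lee_fin RintegralZl//; last first.
  exact: (@integrableD _ _ _ P _ measurableT _ _ ierr2 idev2).
rewrite RintegralD// c2 -/K.
apply: (@le_trans _ _ (2 * n%:R^-1 ^+ 2 *
    ((n%:R * K) ^+ 2 * (b * c n ^+ 2) + n%:R * (2 * K * M) ^+ 2))).
  by rewrite ler_wpM2l ?lerD// mulr_ge0// sqr_ge0.
(* Division by n^2 cancels the n^2 of the estimation part and leaves 1/n in the sampling part. *)
rewrite [leLHS](_ : _ = 2 * K ^+ 2 * b * c n ^+ 2 + 8 * K ^+ 2 * M ^+ 2 * n%:R^-1); last first.
  by field; rewrite gt_eqF.
apply: (@le_trans _ _ (2 * K ^+ 2 * b * c n ^+ 2 + 8 * K ^+ 2 * M ^+ 2 * c n ^+ 2)).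
  by rewrite lerD2l ler_wpM2l ?cn// !mulr_ge0// sqr_ge0.
(* The remaining slack is the contribution of the 1 in the constant. *)
rewrite -subr_ge0 [leRHS](_ : _ = K ^+ 2 * c n ^+ 2); last by ring.
by rewrite mulr_ge0 ?sqr_ge0.
Qed.
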